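(* Let $\mathbf{A}$ be an algebra in a congruence modular variety such that $\mathbf{A}$ has only finitely many congruences. Then there is a finite set $\Phi$ of extended commutator equalities over the congruence lattice $\mathrm{Con}(\mathbf{A})$ such that the sequence of higher commutator operations of $\mathbf{A}$ is the unique operation sequence on $\mathrm{Con}(\mathbf{A})$ that satisfies (HC3), (HC4) and all extended equalities in $\Phi$.
   Context: $\mathbb{N}=\{1,2,\dots\}$, $\mathbb{N}_0=\mathbb{N}\cup\{0\}$. An operation sequence on a lattice $\mathbb{L}$ is a sequence $(f_n)_{n\in\mathbb{N}}$ with $f_n:\mathbb{L}^n\to\mathbb{L}$ for each $n$. We write $[\alpha_1,\dots,\alpha_n]_f$ for $f_n(\alpha_1,\dots,\alpha_n)$. (HC3), omission property: $f_{n+1}(\alpha_1,\dots,\alpha_{n+1})\le f_n(\alpha_2,\dots,\alpha_{n+1})$ for all $n\in\mathbb{N}$ and all $\alpha_1,\dots,\alpha_{n+1}\in\mathbb{L}$. (HC4), symmetry: $f_n(\alpha_1,\dots,\alpha_n)=f_n(\alpha_{\sigma(1)},\dots,\alpha_{\sigma(n)})$ for all $n\in\mathbb{N}$, all $\alpha_1,\dots,\alpha_n\in\mathbb{L}$ and all permutations $\sigma\in S_n$. Extended commutators: for a complete lattice $\mathbb{L}$, $S\subseteq\mathbb{L}$, $n\in\mathbb{N}_0$, $\alpha_1,\dots,\alpha_n\in\mathbb{L}$ and an operation sequence $(f_n)$ on $\mathbb{L}$, $$[S;\alpha_1,\dots,\alpha_n]_f:=\bigwedge\{[\sigma_1,\dots,\sigma_k,\alpha_1,\dots,\alpha_n]_f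 \mid k\in\mathbb{N}_0,\ (\sigma_1,\dots,\sigma_k)\in S^k\},$$ where the commutator of the empty list (the case $k=n=0$) is read as the largest element of $\mathbb{L}$; in particular, for $S=\emptyset$ and $n=0$ the value is the largest element of $\mathbb{L}$. An extended commutator equality over $\mathbb{L}$ is an expression $[S;\alpha_1,\dots,\alpha_n]=\beta$ with $S\subseteq\mathbb{L}$, $n\in\mathbb{N}_0$, $\alpha_1,\dots,\alpha_n,\beta\in\mathbb{L}$; $(f_n)$ satisfies it if $[S;\alpha_1,\dots,\alpha_n]_f=\beta$. Higher commutators (Bulatov): for an algebra $\mathbf{A}$ with universe $A$ and congruences $\alpha_1,\dots,\alpha_n,\delta$, say that $\alpha_1,\dots,\alpha_{n-1}$ centralize $\alpha_n$ modulo $\delta$ if for all $k_1,\dots,k_n\in\mathbb{N}_0$, all tuples $\mathbf{a}_i,\mathbf{b}_i\in A^{k_i}$ that are componentwise congruent modulo $\alpha_i$ ($i=1,\dots,n$), and every polynomial operation $p$ of $\mathbf{A}$ of arity $k_1+\dots+k_n$: if $p(\mathbf{x}_1,\dots,\mathbf{x}_{n-1},\mathbf{a}_n)\equiv_\delta p(\mathbf{x}_1,\dots,\mathbf{x}_{n-1},\mathbf{b}_n)$ for all $(\mathbf{x}_1,\dots,\mathbf{x}_{n-1})\in\big(\prod_{i=1}^{n-1}\{\mathbf{a}_i,\mathbf{b}_i\}\big)\setminus\{(\mathbf{b}_1,\dots,\mathbf{b}_{n-1})\}$, then $p(\mathbf{b}_1,\dots,\mathbf{b}_{n-1},\mathbf{a}_n)\equiv_\delta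 p(\mathbf{b}_1,\dots,\mathbf{b}_{n-1},\mathbf{b}_n)$. The higher commutator $[\alpha_1,\dots,\alpha_n]_{\mathbf{A}}$ is the smallest congruence $\delta$ such that $\alpha_1,\dots,\alpha_{n-1}$ centralize $\alpha_n$ modulo $\delta$ (for $n=1$ this gives $[\alpha]_{\mathbf{A}}=\alpha$). The sequence of higher commutator operations of $\mathbf{A}$ is the operation sequence on $\mathrm{Con}(\mathbf{A})$ given by $f_n(\alpha_1,\dots,\alpha_n)=[\alpha_1,\dots,\alpha_n]_{\mathbf{A}}$.
   Formalization: In the centralizing condition the points of ∏{a_i,b_i} are formal choices of a_i or b_i, and only the all-b choice is excluded; with the literal set difference, a_i=b_i makes the premise void, so [α_1,…,α_n]=α_n and (HC4) fails. *)

(* Defs.v *)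
From HB Require Import structures.
From mathcomp Require Import all_boot all_order all_fingroup.
From mathcomp Require Import boolp classical_sets cardinality.

Set Implicit Arguments.
Unset Strict Implicit.
Unset Printing Implicit Defensive.

Import Order.TTheory.
Local Open Scope classical_set_scope.
Local Open Scope order_scope.

Record signature := Signature {
  op :> Type;
  arity : op -> nat
}.

Record algebra (Sg : signature) := Algebra {
  carrier :> Type;
  interp : forall o : Sg, ('I_(arity o) -> carrier) -> carrier;
  carrier_inhabited : inhabited carrier
}.

Inductive term (Sg : signature) (X : Type) :=
| Var of X
| App (o : Sg) of ('I_(arity o) -> term Sg X).
Arguments Var {Sg X} _.
Arguments App {Sg X} o _.

Fixpoint eval (Sg : signature) (A : algebra Sg) (X : Type) (v : X -> A)
    (t : term Sg X) : A :=
  match t with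
  | Var x => v x
  | App o ts => interp (fun i => eval v (ts i))
  end.

(* A polynomial operation, its arguments being indexed by X, is induced by a
   term whose leaves are either argument positions or constants of A. *)
Definition polynomial_op (Sg : signature) (A : algebra Sg) (X : Type)
    (p : (X -> A) -> A) : Prop :=
  exists t : term Sg (X + A)%type, forall x : X -> A,
    p x = eval (fun u => match u with inl i => x i | inr c => c end) t.

Definition identity (Sg : signature) : Type := term Sg nat * term Sg nat.

Definition holds_in (Sg : signature) (A : algebra Sg) (e : identity Sg) : Prop :=
  forall v : nat -> A, eval v e.1 = eval v e.2.

Definition is_variety (Sg : signature) (V : set (algebra Sg)) : Prop :=
  exists E : set (identity Sg),
    forall A : algebra Sg, V A <-> (forall e, E e -> holds_in A e).

Record congruence (Sg : signature) (A : algebra Sg) := Congruence {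
  con_rel :> A -> A -> Prop;
  con_refl : forall x, con_rel x x;
  con_sym : forall x y, con_rel x y -> con_rel y x;
  con_trans : forall x y z, con_rel x y -> con_rel y z -> con_rel x z;
  con_compat : forall (o : Sg) (x y : 'I_(arity o) -> A),
    (forall i, con_rel (x i) (y i)) -> con_rel (interp x) (interp y)
}.

Fact con_display : Order.disp_t. Proof. exact: Order.Disp tt tt. Qed.

Section CongruenceLattice.
Variables (Sg : signature) (A : algebra Sg).
Implicit Types (a b c : congruence A) (S : set (congruence A)).

Lemma con_ext a b : (forall x y, a x y <-> b x y) -> a = b.
Proof.
case: a b => [a a1 a2 a3 a4] [b b1 b2 b3 b4] /= ab.
have eab : a = b by apply/funext => x; apply/funext => y; apply/propext.
by subst b; congr Congruence; exact: Prop_irrelevance.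
Qed.

HB.instance Definition _ := gen_eqMixin (congruence A).
HB.instance Definition _ := gen_choiceMixin (congruence A).

Definition con_le a b : bool := `[< forall x y, a x y -> b x y >].

Fact con_le_refl : reflexive con_le.
Proof. by move=> a; apply/asboolP. Qed.

Fact con_le_anti : antisymmetric con_le.
Proof. by move=> a b /andP[/asboolP ab /asboolP ba]; apply: con_ext; split; auto. Qed.

Fact con_le_trans : transitive con_le.
Proof. by move=> b a c /asboolP ab /asboolP bc; apply/asboolP; auto. Qed.

HB.instance Definition _ := Order.Le_isPOrder.Build con_display (congruence A)
  con_le_refl con_le_anti con_le_trans.

Lemma con_leP a b : reflect (forall x y, a x y -> b x y) (a <= b).
Proof. exact: asboolP. Qed.

Definition con_inf S : congruence A.
Proof.
exists (fun x y => forall a, S a -> a x y).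
- by move=> x a _; exact: con_refl.
- by move=> x y xy a Sa; apply: con_sym; exact: xy.
- by move=> x y z xy yz a Sa; apply: con_trans (xy a Sa) (yz a Sa).
- by move=> o x y xy a Sa; apply: con_compat => i; exact: xy.
Defined.

Lemma con_infE S x y : con_inf S x y = (forall a, S a -> a x y).
Proof. by []. Qed.

Lemma con_inf_lb S a : S a -> con_inf S <= a.
Proof. by move=> Sa; apply/con_leP => x y; exact. Qed.

Lemma con_inf_glb S b : (forall a, S a -> b <= a) -> b <= con_inf S.
Proof.
by move=> bS; apply/con_leP => x y bxy a Sa; move/con_leP: (bS a Sa); exact.
Qed.

Definition con_meet a b := con_inf [set a; b].
Definition con_join a b := con_inf [set c | a <= c /\ b <= c].

Fact con_lexI a b c : (a <= con_meet b c) = (a <= b) && (a <= c).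
Proof.
apply/idP/andP => [abc|[ab ac]].
  by split; apply: le_trans abc _; apply: con_inf_lb; [left|right].
by apply: con_inf_glb => d [->|->].
Qed.

Fact con_leUx a b c : (con_join a b <= c) = (a <= c) && (b <= c).
Proof.
apply/idP/andP => [abc|[ac bc]]; last exact: con_inf_lb.
by split; apply: le_trans abc; apply: con_inf_glb => d [].
Qed.

HB.instance Definition _ :=
  Order.POrder_isMeetSemilattice.Build con_display (congruence A) con_lexI.
HB.instance Definition _ :=
  Order.POrder_isJoinSemilattice.Build con_display (congruence A) con_leUx.

Fact con_le0x a : con_inf setT <= a.
Proof. exact: con_inf_lb. Qed.

Fact con_lex1 a : a <= con_inf set0.
Proof. exact: con_inf_glb. Qed.

HB.instance Definition _ :=
  Order.hasBottom.Build con_display (congruence A) con_le0x.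
HB.instance Definition _ :=
  Order.hasTop.Build con_display (congruence A) con_lex1.

(* Con(A) is complete, its infima being intersections. *)
Lemma con_infimumE S : infimum \top S = con_inf S.
Proof.
rewrite /infimum; case: ifPn => [/eqP->//|_].
have infS : infimums S (con_inf S).
  split=> [a Sa|b lb]; first exact: con_inf_lb.
  by apply: con_inf_glb => a; exact: lb.
case: xgetP => [a _ /= aS|/(_ (con_inf S))//].
exact: is_subset1_infimums aS infS.
Qed.

End CongruenceLattice.

Definition modular_lattice (d : Order.disp_t) (L : latticeType d) : Prop :=
  forall x y z : L, x <= z -> x `|` (y `&` z) = (x `|` y) `&` z.

Definition congruence_modular (Sg : signature) (V : set (algebra Sg)) : Prop :=
  forall A : algebra Sg, V A -> modular_lattice (congruence A).

Section HigherCommutators.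
Variables (Sg : signature) (A : algebra Sg) (n : nat).
Implicit Types (alpha : 'I_n.+1 -> congruence A) (delta : congruence A).

(* The argument (x_i)_i with x_i = b_i for i in B and x_i = a_i otherwise. *)
Definition vertex (k : 'I_n.+1 -> nat) (a b : forall i, 'I_(k i) -> A)
    (B : {set 'I_n.+1}) (u : {i : 'I_n.+1 & 'I_(k i)}) : A :=
  if tag u \in B then b (tag u) (tagged u) else a (tag u) (tagged u).

(* With n + 1 congruences alpha_0, ..., alpha_n: all but the last centralize
   the last modulo delta.  The points of prod_(i < n) {a_i, b_i} are indexed
   formally, by the set B of the positions at which b_i is chosen, so that
   only the choice of b_i at every position is excluded from the premise, even
   when a_i = b_i for some i.  Removing the vector (b_i)_(i < n) from the set
   of vectors instead would leave the premise void when a_i = b_i for all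
   i < n, and would make the commutator equal to its last argument. *)
Definition centralize alpha delta : Prop :=
  forall (k : 'I_n.+1 -> nat) (a b : forall i, 'I_(k i) -> A)
    (p : ({i : 'I_n.+1 & 'I_(k i)} -> A) -> A),
  polynomial_op p ->
  (forall i j, alpha i (a i j) (b i j)) ->
  (forall B : {set 'I_n.+1}, ord_max \notin B -> B != [set~ ord_max]%SET ->
     delta (p (vertex a b B)) (p (vertex a b (ord_max |: B)%SET))) ->
  delta (p (vertex a b [set~ ord_max]%SET)) (p (vertex a b [set: 'I_n.+1]%SET)).

Definition higher_commutator (t : n.+1.-tuple (congruence A)) : congruence A :=
  con_inf [set delta | centralize (tnth t) delta].

Lemma higher_commutator_centralize t :
  centralize (tnth t) (higher_commutator t).
Proof.
move=> k a b p pp ab H delta cd; apply: (cd k a b p pp ab) => B B1 B2.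
exact: H.
Qed.

Lemma higher_commutator_least t delta :
  centralize (tnth t) delta -> higher_commutator t <= delta.
Proof. by move=> cd; exact: con_inf_lb. Qed.

End HigherCommutators.

(* For f : opseq L, the operation f n has n + 1 arguments,
   so f 0, f 1, ... are the operations f_1, f_2, ... *)

Definition opseq (L : Type) : Type := forall n : nat, n.+1.-tuple L -> L.

Definition higher_commutators (Sg : signature) (A : algebra Sg) :
    opseq (congruence A) :=
  fun n t => higher_commutator t.
Arguments higher_commutators {Sg} A n t.

Section OperationSequences.
Variables (d : Order.disp_t) (L : tbLatticeType d).
Implicit Types (f : opseq L).

Definition HC3 f : Prop :=
  forall (n : nat) (a : L) (t : n.+1.-tuple L), f n.+1 (cons_tuple a t) <= f n t.

Definition HC4 f : Prop :=
  forall (n : nat) (t : n.+1.-tuple L) (s : {perm 'I_n.+1}),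
    f n t = f n [tuple tnth t (s i) | i < n.+1].

Definition bracket f (s : seq L) : L :=
  if s is x :: s' then f (size s') (in_tuple (x :: s')) else \top.

(* This is the intended value only if the infimum exists, in particular when
   L is complete. *)
Definition ext_commutator f (S : set L) (alpha : seq L) : L :=
  infimum \top [set bracket f (sigma ++ alpha)
               | sigma in [set sigma : seq L | forall x, x \in sigma -> S x]].

Record ext_equality := ExtEquality {
  ext_set : set L;
  ext_args : seq L;
  ext_rhs : L
}.

Definition satisfies f (e : ext_equality) : Prop :=
  ext_commutator f (ext_set e) (ext_args e) = ext_rhs e.

End OperationSequences.

(* Main.v *)
(** By the omission property and symmetry, f is an antitone function on the
    multisets over Con(A), that is, on a power of N.  Such a function extends to
    the compact space of points with coordinates in N together with infinity, its value
    at a point with infinite coordinates S being the extended commutator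
    [S; alpha].  As Con(A) is finite, this infimum is attained, so one equality
    for [S; alpha] and one for an ordinary commutator fix f on a
    neighbourhood of that point; finitely many neighbourhoods cover everything.

    It remains to see that higher commutators are symmetric.  Modularity
    provides Day terms t, with t(x,y,y,x) = x.  If p spans a cube, so does
    t(p(y0,z0), p(y0,Z), p(Y,Z), p(Y,z0)), where Y and Z are two of the
    directions, and centrality of this cube in the direction Z gives
    centrality of p in the direction Y. *)

From Stdlib Require Import Relation_Operators.
Require Import Defs.
From mathcomp Require Import all_boot all_order all_fingroup boolp classical_sets cardinality.

Set Implicit Arguments.
Unset Strict Implicit.
Unset Printing Implicit Defensive.

Import Order.TTheory.
Local Open Scope order_scope.

(** * Operation sequences on a finite lattice *)

Section Determination.
Local Open Scope classical_set_scope.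
Variables (d : Order.disp_t) (L : tbLatticeType d).
Implicit Types (f g : opseq L) (S : set L) (a r s t : seq L).

Lemma bracket_tuple f n (t : n.+1.-tuple L) : bracket f t = f n t.
Proof.
case: t => -[//|x s] sz; have en : size s = n by case/eqP: sz.
by subst n; congr (f _ _); exact: val_inj.
Qed.

Lemma bracket_inj f g : bracket f =1 bracket g -> f = g.
Proof.
move=> fg; apply: functional_extensionality_dep => n; apply/funext => t.
by rewrite -!bracket_tuple.
Qed.

Lemma bracket_perm f s t : HC4 f -> perm_eq s t -> bracket f s = bracket f t.
Proof.
move=> f4; case: t => [/perm_nilP->//|y t].
rewrite -[y :: t]/(tval (in_tuple (y :: t))) => /tuple_permP[p ->].
by rewrite !bracket_tuple -f4.
Qed.

Lemma bracket_cat f r s : HC3 f -> bracket f (r ++ s) <= bracket f s.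
Proof.
move=> f3; elim: r => [|x r IH]; first exact: lexx.
rewrite cat_cons; apply: le_trans IH; case: (r ++ s) => [|y t]; first exact: lex1.
rewrite -[x :: y :: t]/(tval (cons_tuple x (in_tuple (y :: t)))) bracket_tuple.
exact: f3.
Qed.

(** By (HC4) only multiplicities matter, and (HC3) lets the surplus elements of [t] be dropped. *)
Lemma bracket_antitone f s t : HC3 f -> HC4 f ->
  (forall x, (count_mem x s <= count_mem x t)%N) -> bracket f t <= bracket f s.
Proof.
move=> f3 f4 /count_subseqP[s' s't pss'].
have [r ptr] := perm_to_subseq s't.
rewrite (bracket_perm f4 pss') (bracket_perm f4 ptr).
by rewrite (bracket_perm (t := r ++ s') f4) ?bracket_cat// perm_catC.
Qed.

Lemma infimum_least (V : set L) v : V v -> lbound V v -> infimum \top V = v.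
Proof.
move=> Vv lv; rewrite /infimum; case: ifPn => [/eqP V0|_].
  by move: Vv; rewrite V0.
have iv : infimums V v by split=> // u; apply.
case: xgetP => [u _ uV|/(_ v)//]; exact: is_subset1_infimums uV iv.
Qed.

(* Prepending further elements of S decreases the bracket, so the values form
   a downward directed set, which has a least element when L is finite. *)
Lemma ext_commutator_attained f S a :
    finite_set [set: L] -> HC3 f -> HC4 f ->
  exists2 r, (forall x, x \in r -> S x) &
    ext_commutator f S a = bracket f (r ++ a) /\
    (forall s, (forall x, x \in s -> S x) ->
       ext_commutator f S a <= bracket f (s ++ a)).
Proof.
move=> /finite_seqP[e eL] f3 f4.
have inL x : x \in e by have : [set: L] x by []; rewrite eL.
(* If u < v, then fewer entries of [e] lie below u than below v. Hence a bracket minimizing this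
   count is minimal among the values, and directedness makes it the least. *)
pose below v := count (fun u : L => u <= v) e.
pose Q k := `[< exists2 r, (forall x, x \in r -> S x) & below (bracket f (r ++ a)) = k >].
have exQ : exists k, Q k by exists (below (bracket f a)); apply/asboolP; exists nil.
have [_ /asboolP[r Sr <-] rmin] := ex_minnP exQ.
have least s : (forall x, x \in s -> S x) -> bracket f (r ++ a) <= bracket f (s ++ a).
  move=> Ss.
  have Ssr x : x \in s ++ r -> S x by rewrite mem_cat => /orP[/Ss|/Sr].
  have le1 : bracket f ((s ++ r) ++ a) <= bracket f (r ++ a).
    by rewrite -catA bracket_cat.
  have le2 : bracket f ((s ++ r) ++ a) <= bracket f (s ++ a).
    by apply: bracket_antitone => // x; rewrite !count_cat leq_add2r leq_addr.
  apply: le_trans le2; have /rmin : Q (below (bracket f ((s ++ r) ++ a))).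
    by apply/asboolP; exists (s ++ r).
  apply: contraTT => nle; rewrite -ltnNge.
  set u := bracket f ((s ++ r) ++ a) in le1 nle *; set v := bracket f (r ++ a) in le1 nle *.
  have v1 : (0 < count (pred1 v) e)%N by rewrite -has_count has_pred1.
  apply: (@leq_trans (below u + count (pred1 v) e)%N).
    by rewrite -addn1 leq_add2l.
  rewrite /below -count_predUI (@eq_count _ (predI _ _) pred0) ?count_pred0 ?addn0.
    apply: sub_count => z /= /orP[zu|/eqP->//]; exact: le_trans zu le1.
  by move=> z /=; apply/negP => /andP[zu /eqP zv]; rewrite -zv zu in nle.
have ev : ext_commutator f S a = bracket f (r ++ a).
  apply: infimum_least; first by exists r.
  by move=> _ [t St <-]; exact: least.
by exists r => //; rewrite ev.
Qed.

(** Uniqueness is claimed only on [D], so that the sets [Phi] of finitely many pieces can be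
    united. *)
Definition axiomatizes (Phi : set (ext_equality L)) f (D : set (seq L)) : Prop :=
  [/\ finite_set Phi, forall e, Phi e -> satisfies f e &
    forall g, HC3 g -> HC4 g -> (forall e, Phi e -> satisfies g e) ->
      forall s, D s -> bracket g s = bracket f s].

(* Lists are identified with points of N^L.  The members of D below
   are fixed off S; the equality [S; a] = v together with v = [r ++ a] pins down
   the value v on all points above r ++ a, and the other points have one
   of finitely many values at some coordinate in S. *)
Lemma axiomatizes_slice f (S a : seq L) :
    finite_set [set: L] -> HC3 f -> HC4 f ->
  exists Phi, axiomatizes Phi f
    [set s | forall x, x \notin S -> count_mem x s = count_mem x a].
Proof.
move=> finL f3 f4; have [n] := ubnP (size S); elim: n S a => // n IH S a ltSn.
have [r Sr [vr _]] := ext_commutator_attained [set` S] a finL f3 f4.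
have /choice[Psi PsiP] (yj : L * nat) : exists Phi, axiomatizes Phi f
    [set s | yj.1 \in S /\ count_mem yj.1 s = yj.2 /\
             forall x, x \notin S -> count_mem x s = count_mem x a].
  case: yj => y j /=; have [yS|yS] := boolP (y \in S); last first.
    exists set0; split=> //.
    by move=> g _ _ _ s [yS' _]; case/negP: yS.
  have ltS : (size [seq x <- S | x != y] < n)%N.
    rewrite size_filter; apply: leq_trans (_ : size S <= n)%N; last by [].
    rewrite -(count_predC (predC1 y) S) -addn1 leq_add2l -has_count.
    by apply/hasP; exists y => //=; rewrite eqxx.
  (* The multiplicity [j] of [y] is recorded in the base list, and [y] leaves [S]. *)
  have [Phi [fin sat det]] := IH [seq x <- S | x != y]
    (nseq j y ++ [seq x <- a | x != y]) ltS.
  exists Phi; split=> // g g3 g4 gsat s [_ [sj sa]]; apply: det => // x.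
  rewrite mem_filter negb_and negbK count_cat count_nseq count_filter /=.
  have [->{x} _|xy /= xS] := eqVneq x y.
    rewrite mul1n sj (@eq_count _ (predI _ _) pred0) ?count_pred0 ?addn0//.
    by move=> z /=; case: eqP.
  rewrite mul0n add0n sa//; apply: eq_count => z /=.
  by case: eqP => // ->.
pose E0 := ExtEquality [set` S] a (bracket f (r ++ a)).
pose E1 := ExtEquality set0 (r ++ a) (bracket f (r ++ a)).
have ext0 g b : HC3 g -> HC4 g -> ext_commutator g set0 b = bracket g b.
  move=> g3 g4; have [[|z t] tP [-> _]//] := ext_commutator_attained set0 b finL g3 g4.
  by have := tP z (mem_head _ _).
exists ([set E0; E1] `|` \bigcup_(y in [set` S])
  \bigcup_(j in [set` iota 0 (count_mem y r + count_mem y a)]) Psi (y, j)).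
split.
- rewrite finite_setU; split; first exact: finite_set2.
  apply: bigcup_finite => // y _; apply: bigcup_finite => // j _.
  by have [] := PsiP (y, j).
- move=> e [[->|->]|[y _ [j _]]]; first exact: vr.
    exact: ext0.
  by have [_ sat _] := PsiP (y, j); exact: sat.
move=> g g3 g4 gsat s sa.
have [/allP/= big|/allPn[y yS small]] :=
    boolP (all (fun y => count_mem y r + count_mem y a <= count_mem y s)%N S); last first.
  have [_ _ det] := PsiP (y, count_mem y s); apply: det => // e Pe.
  apply: gsat; right; exists y => //; exists (count_mem y s) => //=.
  by rewrite mem_iota add0n ltnNge.
suff val h : HC3 h -> HC4 h -> satisfies h E0 -> satisfies h E1 ->
    bracket h s = bracket f (r ++ a).
  rewrite (val g) ?(val f)//.
  - exact: ext0.
  - by apply: gsat; left; left.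
  - by apply: gsat; left; right.
(* Upper bound by [E1]: [s] dominates [r ++ a]. Lower bound by [E0]: [s] is dominated by its own
   elements in [S] prepended to [a]. *)
move=> h3 h4 h0 h1; apply/le_anti/andP; split.
  rewrite -[leRHS]h1 /= ext0//; apply: bracket_antitone => // x.
  rewrite count_cat; have [/big//|xS] := boolP (x \in S).
  rewrite sa// (count_memPn _) //; exact: contra (@Sr x) xS.
have [t _ [_ hmin]] := ext_commutator_attained [set` S] a finL h3 h4.
rewrite -[leLHS]h0 /=.
apply: le_trans (hmin [seq x <- s | x \in S] _) _ => [x|].
  by rewrite mem_filter => /andP[].
apply: bracket_antitone => // x; rewrite count_cat count_filter.
have [xS|xS] := boolP (x \in S); last by rewrite sa// leq_addl.
rewrite (@eq_count _ (predI _ _) (pred1 x)) ?leq_addr// => z /=.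
by case: eqP => // ->.
Qed.

(** When [S] lists all of [L], the slice through the empty list contains every list. *)
Lemma opseq_axiomatizable f :
    finite_set [set: L] -> HC3 f -> HC4 f ->
  exists Phi, finite_set Phi /\
    unique (fun g => HC3 g /\ HC4 g /\ (forall e, Phi e -> satisfies g e)) f.
Proof.
move=> finL f3 f4; have /finite_seqP[S SL] := finL.
have [Phi [fin sat det]] := axiomatizes_slice S [::] finL f3 f4.
exists Phi; split=> //; split=> // g [g3 [g4 gsat]].
apply: bracket_inj => s; symmetry; apply: det => // x /=.
by have : [set: L] x by []; rewrite SL /= => ->.
Qed.

End Determination.

(** * Term operations and Day's condition *)

Section Terms.
Variables (Sg : signature) (A : algebra Sg).

Fixpoint term_bind (X Y : Type) (h : X -> term Sg Y) (t : term Sg X) : term Sg Y :=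
  match t with
  | Var x => h x
  | App o ts => App o (fun i => term_bind h (ts i))
  end.

Lemma eval_bind X Y (h : X -> term Sg Y) (v : Y -> A) t :
  eval v (term_bind h t) = eval (fun x => eval v (h x)) t.
Proof.
by elim: t => //= o ts IH; congr interp; apply/funext => i; exact: IH.
Qed.

Lemma eval_congruence (c : congruence A) X (v w : X -> A) (t : term Sg X) :
  (forall x, c (v x) (w x)) -> c (eval v t) (eval w t).
Proof. by move=> vw; elim: t => //= o ts IH; exact: con_compat. Qed.

Lemma polynomial_op_const (X : Type) (c : A) : polynomial_op (fun _ : X -> A => c).
Proof. by exists (Var (inr c)). Qed.

Lemma polynomial_op_proj (X : Type) (x : X) : polynomial_op (fun u : X -> A => u x).
Proof. by exists (Var (inl x)). Qed.

Lemma polynomial_op_term X Y (t : term Sg Y) (P : Y -> (X -> A) -> A) :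
  (forall y, polynomial_op (P y)) ->
  polynomial_op (fun u => eval (fun y => P y u) t).
Proof.
move=> /choice[h hP]; exists (term_bind h t) => u.
by rewrite eval_bind; congr (eval _ t); apply/funext => y; exact: hP.
Qed.

Lemma polynomial_op_comp X Y (p : (X -> A) -> A) (s : X -> (Y -> A) -> A) :
  polynomial_op p -> (forall x, polynomial_op (s x)) ->
  polynomial_op (fun u => p (fun x => s x u)).
Proof.
move=> [t tP] sP.
have [t' t'P] := @polynomial_op_term Y _ t
  (fun y => match y with inl x => s x | inr c => fun=> c end)
  (fun y => match y with inl x => sP x | inr c => polynomial_op_const Y c end).
exists t' => u; rewrite tP -t'P; congr (eval _ t).
by apply/funext => -[].
Qed.

End Terms.

(** * Joins of congruences as chains *)

Section JoinChain.
Variables (Sg : signature) (A : algebra Sg) (a b : congruence A).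

Let chain := clos_refl_trans A (fun x y => a x y \/ b x y).

Let chain_sym x y : chain x y -> chain y x.
Proof.
elim=> {x y} [x y [xy|xy]|x|x y z _ yx _ zy].
- by apply: rt_step; left; exact: con_sym.
- by apply: rt_step; right; exact: con_sym.
- exact: rt_refl.
- exact: rt_trans zy yx.
Qed.

Let chain_translate (h : A -> A) x y :
  (forall c : congruence A, forall x y, c x y -> c (h x) (h y)) ->
  chain x y -> chain (h x) (h y).
Proof.
move=> hP; elim=> {x y} [x y [xy|xy]|x|x y z _ xy _ yz].
- by apply: rt_step; left; exact: hP.
- by apply: rt_step; right; exact: hP.
- exact: rt_refl.
- exact: rt_trans xy yz.
Qed.

Let chain_compat (o : Sg) (x y : 'I_(arity o) -> A) :
  (forall i, chain (x i) (y i)) -> chain (interp x) (interp y).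
Proof.
(* The tuple [w k] takes its first [k] entries from [y]. Consecutive tuples differ in at most one
   coordinate, so a unary translation carries one to the other. *)
move=> xy; pose w k (i : 'I_(arity o)) := if (i < k)%N then y i else x i.
have -> : y = w (arity o) by apply/funext => i; rewrite /w ltn_ord.
have -> : x = w 0%N by apply/funext.
elim: (arity o : nat) => [|k IH]; first exact: rt_refl.
apply: rt_trans IH _; have [lt_k|le_k] := ltnP k (arity o); last first.
  have -> : w k.+1 = w k; last exact: rt_refl.
  apply/funext => i; rewrite /w ltnS.
  by rewrite (leq_trans (ltn_ord i) le_k) (ltnW (leq_trans (ltn_ord i) le_k)).
pose j := Ordinal lt_k; pose h z := interp (fun i => if i == j then z else w k i).
have -> : interp (w k) = h (x j).
  congr interp; apply/funext => i; have [->|//] := eqVneq i j.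
  by rewrite /w ltnn.
have -> : interp (w k.+1) = h (y j).
  congr interp; apply/funext => i; have [->|ij] := eqVneq i j.
    by rewrite /w leqnn.
  by rewrite /w ltnS leq_eqVlt -[(i == k :> nat)%N]/(i == j) (negbTE ij).
apply: chain_translate => // c u v uv; apply: con_compat => i.
by case: ifP => // _; exact: con_refl.
Qed.
(** The chains form a congruence above [a] and [b]. *)
Lemma con_join_chain x y : (a `|` b) x y -> chain x y.
Proof.
pose c := @Congruence Sg A chain (@rt_refl _ _) chain_sym (@rt_trans _ _) chain_compat.
have /con_leP : a `|` b <= c; last exact.
by rewrite leUx; apply/andP; split; apply/con_leP => u v uv; apply: rt_step; [left|right].
Qed.

End JoinChain.

(** * Free algebras and Day's condition *)

Section TermOperations.
Variables (Sg : signature) (A : algebra Sg) (X : Type) (x0 : X).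

Definition is_term_op (f : (X -> A) -> A) : Prop :=
  exists t : term Sg X, f = (fun v => eval v t).

Lemma is_term_op_proj x : is_term_op (fun v => v x).
Proof. by exists (Var x). Qed.

Lemma is_term_op_interp (o : Sg) (f : 'I_(arity o) -> {f | is_term_op f}) :
  is_term_op (fun v => interp (fun i => sval (f i) v)).
Proof.
have /choice[h hP] i : exists t : term Sg X, sval (f i) = fun v => eval v t.
  exact: svalP (f i).
exists (App o h); apply/funext => v /=; congr interp; apply/funext => i.
by rewrite hP.
Qed.

(* The subalgebra of A ^ (X -> A) generated by the projections, which is the
   free algebra on X in the variety generated by A. *)
Definition term_ops : algebra Sg :=
  @Algebra Sg {f | is_term_op f}
    (fun o f => exist _ _ (is_term_op_interp f))
    (inhabits (exist _ _ (is_term_op_proj x0))).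

Definition term_proj x : term_ops := exist _ _ (is_term_op_proj x).

Lemma eval_term_ops Y (v : Y -> term_ops) (t : term Sg Y) w :
  sval (eval v t) w = eval (fun y => sval (v y) w) t.
Proof.
by elim: t => //= o ts IH; congr interp; apply/funext => i; exact: IH.
Qed.

Lemma term_ops_holds (e : identity Sg) : holds_in A e -> holds_in term_ops e.
Proof.
move=> Ae v; apply: eq_sig_hprop => [f|]; first exact: Prop_irrelevance.
by apply/funext => w; rewrite !eval_term_ops Ae.
Qed.

(** The kernel of restriction to [W]: a pair in it is an identity between term operations, with [W]
    giving the pattern of its variables. *)
Definition agree (W : set (X -> A)) : congruence term_ops.
Proof.
exists (fun f g : term_ops => forall w, W w -> sval f w = sval g w) => //.
- by move=> f g fg w Ww; rewrite fg.
- by move=> f g h fg gh w Ww; rewrite fg// gh.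
- move=> o f g fg w Ww /=; congr interp; apply/funext => i; exact: fg.
Defined.

End TermOperations.

(* Indexed by bool * bool rather than 'I_4, which lies in too large a universe
   for a generating set of an algebra. *)
Definition quad (T : Type) (x y z u : T) (i : bool * bool) : T :=
  match i with
  | (true, true) => x
  | (true, false) => y
  | (false, true) => z
  | (false, false) => u
  end.

(* The conclusion replaces the use of Day terms: the congruences below express
   the three families of Day's identities, and modularity links the first
   to the last projection by a chain of term operations satisfying them. *)
Lemma day_descent (Sg : signature) (V : set (algebra Sg)) (A : algebra Sg) :
    is_variety V -> congruence_modular V -> V A ->
  forall (delta : congruence A) a b c d, delta b d ->
    (forall t : term Sg (bool * bool), (forall x y : A, eval (quad x y y x) t = x) ->
       delta (eval (quad a a c c) t) (eval (quad a b d c) t)) ->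
  delta a c.
Proof.
move=> [E VE] modV VA delta a b c d bd H.
pose Q := @term_ops Sg A (bool * bool) (true, true).
have VQ : V Q by apply/VE => e Ee; apply: term_ops_holds; exact: (VE A).1 VA e Ee.
pose al := @agree Sg A (bool * bool) (true, true) [set w | exists x y : A, w = quad x y y x].
pose be := @agree Sg A (bool * bool) (true, true) [set w | exists x u : A, w = quad x x u u].
pose ga := @agree Sg A (bool * bool) (true, true) [set w | exists x y u : A, w = quad x y y u].
pose pi i : Q := @term_proj Sg A (bool * bool) (true, true) i.
have leg : ga <= al.
  by apply/con_leP => f g fg _ [y [z ->]]; apply: fg; exists y, z, y.
have al03 : al (pi (true, true)) (pi (false, false)) by move=> _ [y [z ->]].
have be_join := con_leP _ _ (leUr be ga); have ga_join := con_leP _ _ (leUl ga be).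
have j03 : (ga `|` be) (pi (true, true)) (pi (false, false)).
  apply: (@con_trans _ _ _ _ (pi (true, false))).
    by apply: be_join => _ [y [z ->]].
  apply: (@con_trans _ _ _ _ (pi (false, true))).
    by apply: ga_join => _ [y [z [u ->]]].
  by apply: be_join => _ [y [z ->]].
(* Since [ga <= al], the modular law confines the [be] links to [al], so every term t on the chain
   satisfies t(x,y,y,x) = x. *)
have {j03} : (ga `|` (be `&` al)) (pi (true, true)) (pi (false, false)).
  by rewrite (modV Q VQ ga be al leg) => _ [->|->].
pose R (f g : Q) := delta (sval f (quad a b d c)) (sval g (quad a b d c)).
have corners (f : Q) : al (pi (true, true)) f -> delta (sval f (quad a a c c)) (sval f (quad a b d c)).
  have [t fE] := svalP f; move=> xf; rewrite fE; apply: H => y z.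
  have := xf (quad y z z y); rewrite fE => <- //; by exists y, z.
move=> /con_join_chain.
(* Values at (a,b,d,c) stay [delta]-related along the chain: a [ga] link is compared at (a,b,b,c),
   using [bd], and a link in the meet at (a,a,c,c), using [corners]. *)
suff ind f g : clos_refl_trans Q (fun f g => ga f g \/ (be `&` al) f g) f g ->
    al f g /\ (al (pi (true, true)) f -> R f g).
  by move=> /ind[_]; apply; exact: con_refl.
elim=> {f g} [f g [fg|fg]|f|f g h _ [fg Rfg] _ [gh Rgh]].
- split=> [|_]; first by move/con_leP: leg; exact.
  have near (k : Q) : delta (sval k (quad a b d c)) (sval k (quad a b b c)).
    have [t ->] := svalP k; apply: eval_congruence => i.
    by case: i => -[] [] /=; [exact: con_refl..|exact: con_sym|exact: con_refl].
  apply: con_trans (near f) _; rewrite fg; last by exists a, b, c.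
  exact: con_sym.
- have afg : al f g by move: fg; have /con_leP := @leIr _ _ al be; exact.
  have bfg : be f g by move: fg; have /con_leP := @leIl _ _ be al; exact.
  split=> // xf; apply: con_trans (con_sym (corners f xf)) _.
  rewrite bfg; last by exists a, c.
  exact: corners (con_trans xf afg).
- by split=> // _; exact: con_refl.
- split=> [|xf]; first exact: con_trans fg gh.
  exact: con_trans (Rfg xf) (Rgh (con_trans xf fg)).
Qed.

(** * Symmetry of higher commutators *)

Section Centralizes.
Local Open Scope set_scope.
Variables (Sg : signature) (A : algebra Sg) (I : finType).
Implicit Types (alpha : I -> congruence A) (delta : congruence A) (m : I).

Definition corner (X : Type) (J : finType) (c : X -> J) (a b : X -> A) (B : {set J}) (x : X) : A :=
  if c x \in B then b x else a x.

(* The centralizing condition with distinguished position m, the block of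
   each variable x of the polynomial being given by a colour c x. *)
Definition centralizes alpha delta m : Prop :=
  forall (X : finType) (c : X -> I) (a b : X -> A) (p : (X -> A) -> A),
  polynomial_op p ->
  (forall x, alpha (c x) (a x) (b x)) ->
  (forall B : {set I}, m \notin B -> B != [set~ m] ->
     delta (p (corner c a b B)) (p (corner c a b (m |: B)))) ->
  delta (p (corner c a b [set~ m])) (p (corner c a b [set: I])).

Lemma centralizes_reindex alpha delta (s : {perm I}) m :
  centralizes alpha delta (s m) -> centralizes (alpha \o s) delta m.
Proof.
move=> cent X c a b p pp ab H.
have cE B : corner (s \o c) a b B = corner c a b (s @^-1: B).
  by apply/funext => x; rewrite /corner inE.
have := cent X (s \o c) a b p pp ab; rewrite !cE.
have -> : s @^-1: [set~ s m] = [set~ m] by apply/setP => i; rewrite !inE (inj_eq perm_inj).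
have -> : s @^-1: [set: I] = [set: I] by apply/setP => i; rewrite !inE.
apply=> B mB Bm; rewrite !cE.
have -> : s @^-1: (s m |: B) = m |: s @^-1: B.
  by apply/setP => i; rewrite !inE (inj_eq perm_inj).
apply: H; first by rewrite inE.
apply: contraNneq Bm => e; apply/eqP/setP => i.
by have /setP/(_ ((s^-1)%g i)) := e; rewrite !inE permKV => ->; rewrite -(inj_eq (@perm_inj _ s)) permKV.
Qed.

(* q evaluates a term t with t(x,y,y,x) = x at the corners of the squares
   spanned by the directions m' and m, with the corner a of day_descent at m = b,
   m' = a.  The pairs of q-values along m are then equal when
   m' is at a, and delta-related wherever the m'-lines of p are. *)
Lemma centralizes_exchange alpha delta m m' :
  (forall a b c d, delta b d ->
    (forall t : term Sg (bool * bool), (forall x y : A, eval (quad x y y x) t = x) ->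
       delta (eval (quad a a c c) t) (eval (quad a b d c) t)) -> delta a c) ->
  centralizes alpha delta m -> centralizes alpha delta m'.
Proof.
move=> day; have [->//|mm'] := eqVneq m m'.
move=> cent X c a b p pp ab H.
pose P B := p (corner c a b B).
have PE (B : {set I}) : m' \notin B -> B != [set~ m'] -> delta (P B) (P (m' |: B)) by exact: H.
have m'm : m' \in [set~ m] by rewrite !inE eq_sym.
have mm'C : m \in [set~ m'] by rewrite !inE.
have e1 : m |: [set~ m] :\ m' = [set~ m'].
  by apply/setP => i; rewrite !inE; have [->|] := eqVneq i m; rewrite ?mm' ?andbT.
have e2 : m' |: [set~ m] :\ m' = [set~ m] by rewrite finset.setD1K.
have e3 : m |: [set~ m] = [set: I] by apply/setP => i; rewrite !inE orbN.
rewrite -[p (corner _ _ _ _)]/(P _) -[p (corner _ _ _ [set: I])]/(P _).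
apply: (day _ (P ([set~ m] :\ m')) _ (P [set~ m])).
  (* The corners b and d span the line in direction [m'] with [m] at a; it is not the excluded
     line. *)
  rewrite -[in X in delta _ X]e2; apply: PE; first by rewrite !inE eqxx.
  by apply: contraTneq mm'C => <-; rewrite !inE eqxx andbF.
move=> t tP.
pose q u := eval (quad
  (p (fun x => if c x == m then b x else if c x == m' then a x else u x))
  (p (fun x => if c x == m' then a x else u x))
  (p u)
  (p (fun x => if c x == m then b x else u x))) t.
have pq : polynomial_op q.
  pose ps (i : bool * bool) (u : X -> A) := quad
    (p (fun x => if c x == m then b x else if c x == m' then a x else u x))
    (p (fun x => if c x == m' then a x else u x))
    (p u)
    (p (fun x => if c x == m then b x else u x)) i.
  apply: (@polynomial_op_term _ _ X _ t ps) => i; rewrite /ps /quad.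
  case: i => -[] [].
  - apply: (polynomial_op_comp (s := fun x u => if c x == m then b x else if c x == m' then a x else u x) pp) => x.
    case: (c x == m); first exact: polynomial_op_const.
    by case: (c x == m'); [exact: polynomial_op_const|exact: polynomial_op_proj].
  - apply: (polynomial_op_comp (s := fun x u => if c x == m' then a x else u x) pp) => x.
    by case: (c x == m'); [exact: polynomial_op_const|exact: polynomial_op_proj].
  - exact: pp.
  - apply: (polynomial_op_comp (s := fun x u => if c x == m then b x else u x) pp) => x.
    by case: (c x == m); [exact: polynomial_op_const|exact: polynomial_op_proj].
have qE B : q (corner c a b B) =
    eval (quad (P (m |: B :\ m')) (P (B :\ m')) (P B) (P (m |: B))) t.
  rewrite /q; congr (eval (quad _ _ _ _) t); congr p; apply/funext => x;
  rewrite /corner !inE; do ?case: eqP => //=.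
have qmE (B : {set I}) : m \notin B -> q (corner c a b (m |: B)) =
    eval (quad (P (m |: B :\ m')) (P (m |: B :\ m')) (P (m |: B)) (P (m |: B))) t.
  move=> mB; rewrite qE; congr (eval (quad _ _ _ _) t); congr P; apply/setP => i;
  rewrite !inE; have [->|//] := eqVneq i m; by rewrite ?mm'.
have := cent X c a b q pq ab; rewrite -{1}e3 (qmE [set~ m]) ?inE ?eqxx// qE e1 e3 => concl.
apply: con_sym; apply: concl => B mB Bm; rewrite qmE// qE.
have [m'B|m'B] := boolP (m' \in B); last first.
  have -> : B :\ m' = B by apply/finset.setDidPl; rewrite disjoint_sym disjoints1.
  by rewrite !tP; exact: con_refl.
have PB : delta (P (B :\ m')) (P B).
  rewrite -{2}(finset.setD1K m'B); apply: PE; first by rewrite !inE eqxx.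
  by apply: contraTneq mm'C => <-; rewrite !inE (negbTE mB) andbF.
have PmB : delta (P (m |: B :\ m')) (P (m |: B)).
  have -> : m |: B = m' |: (m |: B :\ m').
    by apply/setP => i; rewrite !inE; have [->|//] := eqVneq i m'; rewrite m'B orbT.
  apply: PE; first by rewrite !inE eqxx eq_sym (negbTE mm').
  apply: contraNneq Bm => e; apply/eqP/setP => i; have /setP/(_ i) := e.
  rewrite !inE; have [->|im] := eqVneq i m; first by rewrite (negbTE mB).
  by have [->|//] := eqVneq i m'; rewrite m'B.
set a' := P (m |: B :\ m') in PmB *.
(* Both values of [q] are [delta]-related to [a']: moving entries along [PB] and [PmB] turns them
   into the form t(x,y,y,x). *)
apply: (@con_trans _ _ _ _ a').
  rewrite -{2}(tP a' (P (B :\ m'))); apply: eval_congruence => i.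
  by case: i => -[] []; [exact: con_refl..|exact: con_sym|exact: con_sym].
rewrite -{1}(tP a' a'); apply: eval_congruence => i.
by case: i => -[] []; [exact: con_refl..|exact: PmB|exact: PmB].
Qed.

End Centralizes.

(** * (HC3) and (HC4) for higher commutators *)

Section HigherCommutatorProperties.
Local Open Scope set_scope.
Variables (Sg : signature) (A : algebra Sg).

(** Blocks are colour classes of the tagged variables; conversely, enumerating each colour class
    yields blocks. *)
Lemma centralizeP n (alpha : 'I_n.+1 -> congruence A) delta :
  centralize alpha delta <-> centralizes alpha delta ord_max.
Proof.
split=> [cent X c a b p pp ab H|cent k a b p pp ab]; last first.
  exact: (cent _ (@tag _ _) (fun u => a (tag u) (tagged u))
    (fun u => b (tag u) (tagged u)) p pp).
pose k i := #|[pred x | c x == i]|.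
pose sec (x : X) : {i & 'I_(k i)} :=
  Tagged (fun i => 'I_(k i)) (enum_rank_in (eqxx (c x) : x \in [pred y | c y == c x]) x).
pose a' i (j : 'I_(k i)) := a (enum_val j); pose b' i (j : 'I_(k i)) := b (enum_val j).
have secK x : enum_val (tagged (sec x)) = x by rewrite enum_rankK_in// inE.
have vE B : (fun x => vertex a' b' B (sec x)) = corner c a b B.
  by apply/funext => x; rewrite /vertex /corner /a' /b' secK.
have := cent k a' b' (fun u => p (fun x => u (sec x))).
rewrite !vE; apply=> [|i j|B mB Bm]; last by rewrite !vE; exact: H.
  by apply: (polynomial_op_comp pp) => x; exact: polynomial_op_proj.
by have := ab (enum_val j); have /eqP-> := enum_valP j.
Qed.

(* A block of variables becomes constant by setting a := b on it, after which
   it may be merged into any other block. *)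
Lemma higher_commutators_HC3 : HC3 (higher_commutators A).
Proof.
move=> n al t; apply: higher_commutator_least; apply/centralizeP.
have /centralizeP cent := @higher_commutator_centralize _ _ _ t.
move=> X c a b p pp ab H.
(* [up B] is [B] shifted by one together with position 0, so the excluded vertex goes to the
   excluded vertex. *)
pose up (B : {set 'I_n.+1}) : {set 'I_n.+2} :=
  [set i | if unlift ord0 i is Some j then j \in B else true].
pose c' x := odflt ord_max (unlift ord0 (c x)).
pose a' x := if c x == ord0 then b x else a x.
have cE B : corner c' a' b B = corner c a b (up B).
  apply/funext => x; rewrite /corner /a' /c' inE.
  by case: unliftP => [j|] -> /=; rewrite ?eqxx ?if_same.
have liftM (j : 'I_n.+1) : (lift ord0 j == ord_max) = (j == ord_max).
  by rewrite -!val_eqE /= /bump /= add1n eqSS.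
have up_max : up [set~ ord_max] = [set~ ord_max].
  apply/setP => i; rewrite !inE; case: unliftP => [j|] -> //.
  by rewrite !inE liftM.
have upT : up [set: _] = [set: _].
  by apply/setP => i; rewrite !inE; case: unliftP => // j _; rewrite inE.
rewrite -up_max -upT -!cE; apply: cent => // [x|B mB Bm].
  rewrite /a' /c'; have := ab x; case: unliftP => [j|] -> /=.
    by rewrite tnthS.
  by move=> _; exact: con_refl.
rewrite !cE.
have -> : up (ord_max |: B) = ord_max |: up B.
  apply/setP => i; rewrite !inE; case: unliftP => [j|] ->; rewrite ?orbT//.
  by rewrite !inE liftM.
apply: H.
  have <- : lift ord0 ord_max = ord_max :> 'I_n.+2 by apply/eqP; rewrite liftM.
  by rewrite inE liftK.
apply: contraNneq Bm => e; apply/eqP/setP => j.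
by have /setP/(_ (lift ord0 j)) := e; rewrite !inE liftK liftM.
Qed.

(** The distinguished position is first exchanged for its image under the permutation, then the
    positions are renamed; the converse uses the inverse permutation. *)
Lemma higher_commutators_HC4 (V : set (algebra Sg)) :
  is_variety V -> congruence_modular V -> V A -> HC4 (higher_commutators A).
Proof.
move=> varV modV VA n t s; congr con_inf; apply/predeqP => delta /=.
pose alpha := tnth t.
have -> : tnth [tuple tnth t (s i) | i < n.+1] = alpha \o s.
  by apply/funext => i; rewrite tnth_mktuple.
have day := day_descent varV modV VA (delta := delta).
rewrite !centralizeP; split=> cent.
  exact: centralizes_reindex (centralizes_exchange day cent).
have -> : tnth t = (alpha \o s) \o (s^-1)%g by apply/funext => i /=; rewrite permKV.
exact: centralizes_reindex (centralizes_exchange day cent).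
Qed.

End HigherCommutatorProperties.

Theorem theorem9p5 (Sg : signature) (V : set (algebra Sg)) (A : algebra Sg) :
  is_variety V -> congruence_modular V -> V A ->
  finite_set [set: congruence A]%classic ->
  exists Phi : set (ext_equality (congruence A)),
    finite_set Phi /\
    unique (fun f : opseq (congruence A) =>
              HC3 f /\ HC4 f /\ (forall e, Phi e -> satisfies f e))
           (higher_commutators A).
Proof.
move=> varV modV VA finA; apply: opseq_axiomatizable finA _ _.
  exact: higher_commutators_HC3.
exact: higher_commutators_HC4 varV modV VA.
Qed.
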